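(* Let $A$ be a $v\times v$ complex matrix that has precisely two principal $k\times k$ minors $a$ and $b$ (that is, the set of values taken by the $k\times k$ principal minors of $A$ is $\{a,b\}$ with $a\neq b$). Suppose that, for each $i\in\{0,1,\dots,t\}$, the coefficient of $x^{v-k-i}$ of the characteristic polynomial of each principal $(v-i)\times(v-i)$ submatrix of $A$ is constant (that is, it takes the same value for all principal $(v-i)\times(v-i)$ submatrices of $A$). Then the hypergraph $\mathfrak H_A(v,k,a)$ is a $t$-$(v,k,\lambda)$ design (for some $\lambda$).
   Context: Here $t$, $v$, $k$ are positive integers. For a $v\times v$ matrix $A$ with rows and columns indexed by $\{1,\dots,v\}$, $\mathfrak H_A(v,k,a)$ is the $k$-uniform hypergraph with vertex set $\{1,\dots,v\}$ whose hyperedges are the $k$-subsets of $\{1,\dots,v\}$ whose corresponding principal minor of $A$ is equal to $a$. The characteristic polynomial of a square matrix $M$ is $\det(xI-M)$. For positive integers $t,v,k,\lambda$, a $t$-$(v,k,\lambda)$ design is a $k$-uniform hypergraph on a $v$-element vertex set with the property that any set of $t$ vertices appear together in precisely $\lambda$ hyperedges. *)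

(* Defs.v *)
From mathcomp Require Export all_boot all_order all_algebra.
From mathcomp Require Export reals complex.
Set Implicit Arguments.
Unset Strict Implicit.
Unset Printing Implicit Defensive.
Import GRing.Theory.
Local Open Scope ring_scope.

(* [enum_val] lists the elements of S in increasing order, so rows and columns
   keep the order they have in A. *)
Definition principal_submx (C : Type) (v : nat) (A : 'M[C]_v) (S : {set 'I_v}) :
    'M[C]_#|S| :=
  mxsub (fun i : 'I_#|S| => enum_val i) (fun j : 'I_#|S| => enum_val j) A.

Definition principal_minor (C : comNzRingType) (v : nat) (A : 'M[C]_v)
    (S : {set 'I_v}) : C :=
  \det (principal_submx A S).

(* The coefficient of x^n in p for an integer exponent n: it is 0 when n < 0,
   which avoids a truncated exponent when v - k - i is negative. *)
Definition coefz (C : nzRingType) (p : {poly C}) (n : int) : C :=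
  if n is Posz m then p`_m else 0.

(* A hypergraph on the vertex set T is given by its set of hyperedges. *)
Definition minor_hypergraph (C : comNzRingType) (v : nat) (A : 'M[C]_v)
    (k : nat) (a : C) : {set {set 'I_v}} :=
  [set K : {set 'I_v} | (#|K| == k) && (principal_minor A K == a)].

Definition uniform_hypergraph (T : finType) (k : nat) (H : {set {set T}}) : Prop :=
  forall K : {set T}, K \in H -> #|K| = k.

Definition is_design (T : finType) (t v k lambda : nat) (H : {set {set T}}) : Prop :=
  [/\ [/\ (0 < t)%N, (0 < v)%N, (0 < k)%N & (0 < lambda)%N],
      #|T| = v,
      uniform_hypergraph k H
    & forall X : {set T}, #|X| = t -> #|[set K in H | X \subset K]| = lambda].

(* Main.v *)
(** The coefficient of x^(|S|-k) in the characteristic polynomial of the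
    principal submatrix A[S] is (-1)^k times the sum of the k x k principal
    minors of A indexed by subsets of S.  Since only the values a <> b occur,
    this coefficient determines the number of hyperedges contained in S, i.e.
    avoiding the complement of S.  So the number of hyperedges avoiding a set of
    i <= t vertices depends only on i, and inclusion-exclusion gives the same for
    the number of hyperedges containing a set of i <= t vertices.  Were k <= t,
    the case i = k would make all k x k minors equal; hence t < k, and a
    hyperedge contains some t-set, so that lambda > 0. *)
Require Import Defs.
From mathcomp Require Import perm.
Set Implicit Arguments.
Unset Strict Implicit.
Unset Printing Implicit Defensive.
Import Order.TTheory GRing.Theory Num.Theory.
Local Open Scope ring_scope.

(** Rows and columns undergo the same permutation, so the two signs cancel. The sizes [m] and [n]
    stay syntactically distinct so that [f] may start from an index type such as
    ['I_(#|J| + #|~: J|)]. *)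
Lemma det_mxsub_bij (C : comNzRingType) (m n : nat) (f : 'I_m -> 'I_n)
    (M : 'M[C]_n) : bijective f -> \det (mxsub f f M) = \det M.
Proof.
move=> bijf.
have emn : m = n by rewrite -(card_ord m) -(card_ord n) (bij_eq_card bijf).
case: n / emn f bijf M => f /bij_inj injf M.
have -> : mxsub f f M = row_perm (perm injf) (col_perm (perm injf) M).
  by apply/matrixP => i j; rewrite !mxE !permE.
rewrite row_permE col_permE !det_mulmx !det_perm mulrCA.
by rewrite -signr_addb odd_permV addbb mulr1.
Qed.

(** Listing the indices of [J] first makes the matrix block upper triangular: a row outside [J]
    vanishes off the diagonal. *)
Lemma det_rows_diag (C : comNzRingType) (n : nat) (J : {set 'I_n})
    (B : 'M[C]_n) (c : 'I_n -> C) :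
  \det (\matrix_(i, j) if i \in J then B i j else c i *+ (i == j))
  = (\prod_(i in ~: J) c i) * principal_minor B J.
Proof.
pose f (u : 'I_(#|J| + #|~: J|)) : 'I_n :=
  match split u with inl p => enum_val p | inr q => enum_val q end.
have fl (p : 'I_#|J|) : f (lshift _ p) = enum_val p.
  by rewrite /f -[lshift _ p]/(unsplit (inl p)) unsplitK.
have fr (q : 'I_#|~: J|) : f (rshift _ q) = enum_val q.
  by rewrite /f -[rshift _ q]/(unsplit (inr q)) unsplitK.
have fJ (p : 'I_#|J|) : enum_val p \in J by exact: enum_valP.
have fJC (q : 'I_#|~: J|) : (enum_val q \in J) = false.
  by apply/negbTE; rewrite -in_setC; exact: enum_valP.
have bijf : bijective f.
  apply: inj_card_bij; last by rewrite !card_ord cardsC card_ord.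
  move=> x y; rewrite -(splitK x) -(splitK y).
  case: (split x) => p; case: (split y) => q; rewrite /= ?fl ?fr => e.
  - by rewrite (enum_val_inj e).
  - by have := fJ p; rewrite e fJC.
  - by have := fJ q; rewrite -e fJC.
  - by rewrite (enum_val_inj e).
rewrite -(det_mxsub_bij _ bijf).
set M := mxsub _ _ _.
have -> : M = block_mx (principal_submx B J) (ursubmx M) 0
                (diag_mx (\row_q c (@enum_val _ (pred_of_set (~: J)) q))).
  rewrite -[LHS]submxK; congr block_mx; apply/matrixP => p q; rewrite !mxE.
  - by rewrite !fl fJ.
  - by rewrite fl fr fJC; case: eqP => // e; have := fJ q; rewrite -e fJC.
  - by rewrite !fr fJC (inj_eq enum_val_inj).
rewrite det_ublock det_diag mulrC; congr (_ * _).
by rewrite [RHS]big_enum_val; apply: eq_bigr => q _; rewrite mxE.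
Qed.

(** Multilinearity in the rows: [J] records the rows taken from [F]. *)
Lemma det_addmx (C : comNzRingType) (n : nat) (F G : 'M[C]_n) :
  \det (F + G)
  = \sum_(J : {set 'I_n}) \det (\matrix_(i, j) if i \in J then F i j else G i j).
Proof.
rewrite /determinant [RHS]exchange_big /=; apply: eq_bigr => s _.
rewrite -big_distrr /=; congr (_ * _).
under eq_bigr => i _ do rewrite mxE.
rewrite bigA_distr; apply: eq_bigr => J _.
by apply: eq_bigr => i _; rewrite mxE.
Qed.

Lemma char_poly_principal_submx (C : comNzRingType) (n : nat) (A : 'M[C]_n)
    (S : {set 'I_n}) :
  char_poly (principal_submx A S)
  = \sum_(J : {set 'I_n} | J \subset S)
      ((-1) ^+ #|J| * principal_minor A J) *: 'X^(#|S| - #|J|).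
Proof.
(* The matrix xI - A[S] is padded to size [n] with identity rows outside [S], which keeps its
   determinant and lets every index set live in ['I_n]. [F] carries the entries of -A, [G] the
   diagonal. *)
pose F : 'M[{poly C}]_n := \matrix_(i, j) if i \in S then - (A i j)%:P else 0.
pose G : 'M[{poly C}]_n :=
  \matrix_(i, j) ((if i \in S then 'X else 1) *+ (i == j)).
have -> : char_poly (principal_submx A S) = \det (F + G).
  have -> : F + G = \matrix_(i, j)
      if i \in S then char_poly_mx A i j else 1 *+ (i == j).
    by apply/matrixP => i j; rewrite !mxE; case: ifP; rewrite ?add0r // addrC.
  rewrite (det_rows_diag S (char_poly_mx A) (fun=> 1)) big1 // mul1r.
  congr (\det _); apply/matrixP => i j.
  by rewrite !mxE (inj_eq enum_val_inj).
rewrite det_addmx [RHS]big_mkcond; apply: eq_bigr => J _.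
(* If [J] is not inside [S], some row is a zero row of [F] and the term vanishes. *)
case: ifPn => [JS | /subsetPn[i iJ iS]]; last first.
  rewrite (expand_det_row _ i) big1 // => j _.
  by rewrite !mxE iJ (negbTE iS) mul0r.
have -> : (\matrix_(i, j) if i \in J then F i j else G i j) =
    \matrix_(i, j) if i \in J then (- map_mx polyC A) i j
                   else (if i \in S then 'X else 1) *+ (i == j).
  apply/matrixP => i j; rewrite !mxE; case: ifP => // iJ.
  by rewrite (subsetP JS).
rewrite det_rows_diag.
have -> : \prod_(i in ~: J) (if i \in S then 'X else 1)
          = 'X^(#|S| - #|J|) :> {poly C}.
  rewrite -big_mkcondr /= prodr_const -{2}(setIidPr JS) -cardsD.
  by congr (_ ^+ _); apply: eq_card => i; rewrite [LHS]/in_mem /= !inE.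
have -> : principal_minor (- map_mx polyC A) J
          = ((-1) ^+ #|J| * principal_minor A J)%:P.
  rewrite polyCM rmorphXn rmorphN1 /principal_minor -det_map_mx -detZ scaleN1r.
  by congr (\det _); apply/matrixP => i j; rewrite !mxE.
by rewrite mulrC mul_polyC.
Qed.

Lemma coef_char_poly_principal_submx (C : comNzRingType) (n k m : nat)
    (A : 'M[C]_n) (S : {set 'I_n}) : (m + k = #|S|)%N ->
  (char_poly (principal_submx A S))`_m
  = (-1) ^+ k * \sum_(K : {set 'I_n} | (K \subset S) && (#|K| == k))
                   principal_minor A K.
Proof.
move=> emk; rewrite char_poly_principal_submx coef_sum big_distrr big_mkcondr /=.
apply: eq_bigr => K /subset_leq_card leK.
rewrite coefZ coefXn.
(* The truncated subtraction is exact because [K] lies in [S]. *)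
have -> : (m == #|S| - #|K|)%N = (#|K| == k).
  by rewrite -(eqn_add2r #|K|) subnK // -emk eqn_add2l eq_sym.
by case: eqP => [->|_]; rewrite ?mulr1 ?mulr0.
Qed.

(** Each minor is [b], plus the correction [a - b] when it equals [a]. *)
Lemma sum_two_valued_minors (C : comNzRingType) (n k : nat) (A : 'M[C]_n)
    (a b : C) (S : {set 'I_n}) :
  (forall K : {set 'I_n}, #|K| = k ->
     principal_minor A K = a \/ principal_minor A K = b) ->
  \sum_(K : {set 'I_n} | (K \subset S) && (#|K| == k)) principal_minor A K
  = b *+ 'C(#|S|, k)
    + (a - b) *+ #|[set K in minor_hypergraph A k a | K \subset S]|.
Proof.
move=> Aab; rewrite -cards_draws -!sumr_const.
rewrite [X in _ = X + _](eq_bigl (fun K : {set 'I_n} => (K \subset S) && (#|K| == k)));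
  last by move=> K; rewrite inE.
rewrite [X in _ = _ + X](eq_bigl (fun K : {set 'I_n} =>
  (K \subset S) && (#|K| == k) && (principal_minor A K == a))); last first.
  by move=> K; rewrite !inE [LHS]andbC andbA.
rewrite [X in _ = _ + X]big_mkcondr -big_split /=.
apply: eq_bigr => K /andP[_ /eqP /Aab].
case: eqP => [-> _|ne [//|->]]; first by rewrite addrC subrK.
by rewrite addr0.
Qed.

(** Inclusion-exclusion one vertex at a time, by induction on [#|X|]: moving a vertex from [X] to
    [Y] preserves [#|X| + #|Y|], so the bound [t] survives. *)
Lemma card_containing_avoiding (T : finType) (H : {set {set T}}) (t : nat) :
  (forall Y Y' : {set T}, #|Y| = #|Y'| -> (#|Y| <= t)%N ->
     #|[set K in H | K \subset ~: Y]| = #|[set K in H | K \subset ~: Y']|) ->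
  forall X X' Y Y' : {set T}, #|X| = #|X'| -> #|Y| = #|Y'| ->
    [disjoint X & Y] -> [disjoint X' & Y'] -> (#|X| + #|Y| <= t)%N ->
  #|[set K in H | (X \subset K) && (K \subset ~: Y)]|
  = #|[set K in H | (X' \subset K) && (K \subset ~: Y')]|.
Proof.
move=> avoid X; move: {2}#|X| (erefl #|X|) => m.
elim: m X => [|m IHm] X Xm X' Y Y' eX eY dXY dXY' leXY.
  have [-> ->] : X = set0 /\ X' = set0.
    by split; apply/eqP; rewrite -cards_eq0 -?eX Xm.
  have drop0 (Z : {set T}) :
      [set K in H | (set0 \subset K) && (K \subset ~: Z)]
      = [set K in H | K \subset ~: Z].
    by apply/setP => K; rewrite !inE sub0set.
  rewrite !drop0; apply: avoid => //.
  by apply: leq_trans leXY; exact: leq_addl.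
(* The sets containing [U :\ x] and avoiding [W] split according to whether they contain [x]. *)
have recur (x : T) (U W : {set T}) : x \in U ->
    #|[set K in H | (U \subset K) && (K \subset ~: W)]|
    = (#|[set K in H | (U :\ x \subset K) && (K \subset ~: W)]|
       - #|[set K in H | (U :\ x \subset K) && (K \subset ~: (x |: W))]|)%N.
  move=> xU; set P := [set K in H | (U :\ x \subset K) && (K \subset ~: W)].
  have -> : [set K in H | (U \subset K) && (K \subset ~: W)]
            = P :&: [set K : {set T} | x \in K].
    apply/setP => K; rewrite !inE -{1}(setD1K xU) subUset sub1set.
    by case: (K \in H); case: (x \in K); case: (_ \subset K); case: (_ \subset _).
  have -> : [set K in H | (U :\ x \subset K) && (K \subset ~: (x |: W))]
            = P :\: [set K : {set T} | x \in K].
    apply/setP => K; rewrite !inE setCU setIC -setDE subsetD1.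
    by case: (K \in H); case: (x \in K); case: (_ \subset K); case: (_ \subset _).
  by rewrite -[in RHS](cardsID [set K : {set T} | x \in K] P) addnK.
have /card_gt0P[x xX] : (0 < #|X|)%N by rewrite Xm.
have /card_gt0P[x' xX'] : (0 < #|X'|)%N by rewrite -eX Xm.
have cX : #|X :\ x| = m by move: Xm; rewrite (cardsD1 x) xX => -[].
have cX' : #|X' :\ x'| = m by move: Xm; rewrite eX (cardsD1 x') xX' => -[].
have xY : x \notin Y by rewrite (disjointFr dXY).
have xY' : x' \notin Y' by rewrite (disjointFr dXY').
have disj1 (z : T) (U W : {set T}) : [disjoint U & W] -> [disjoint U :\ z & W].
  by apply: disjointWl; exact: subsetDl.
have disj2 (z : T) (U W : {set T}) : [disjoint U & W] -> [disjoint U :\ z & z |: W].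
  move=> dUW; rewrite disjoints_subset; apply/subsetP => y; rewrite !inE.
  by case/andP=> /negbTE-> yU; rewrite (disjointFr dUW).
rewrite (recur x X Y) // (recur x' X' Y') //; congr (_ - _)%N; apply: IHm;
  rewrite ?cX ?cX' ?cardsU1 ?xY ?xY' ?eY //; try by [exact: disj1 | exact: disj2].
  by apply: leq_trans leXY; rewrite Xm eY leq_add2r.
by rewrite addnA addn1 -Xm -eY.
Qed.

(** The coefficient is an affine function of the count with slope [a - b] up to sign; as the slope
    is nonzero and the characteristic is 0, the count can be recovered. *)
Lemma minor_hypergraph_card_subset (C : numDomainType) (v k i : nat)
    (A : 'M[C]_v) (a b : C) : a <> b ->
  (forall K : {set 'I_v}, #|K| = k ->
     principal_minor A K = a \/ principal_minor A K = b) ->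
  forall S1 S2 : {set 'I_v}, (#|S1| + i = v)%N -> (#|S2| + i = v)%N ->
    coefz (char_poly (principal_submx A S1)) (v%:Z - k%:Z - i%:Z)
    = coefz (char_poly (principal_submx A S2)) (v%:Z - k%:Z - i%:Z) ->
  #|[set K in minor_hypergraph A k a | K \subset S1]|
  = #|[set K in minor_hypergraph A k a | K \subset S2]|.
Proof.
move=> nab Aab S1 S2 eS1 eS2.
have eS : #|S2| = #|S1| by apply: (@addIn i); rewrite eS1 eS2.
(* Here the exponent is negative and [coefz] carries no information, but no [k]-subset fits, so both
   counts are 0. *)
have [ltSk _ | leSk] := ltnP #|S1| k.
  have none (S : {set 'I_v}) : #|S| = #|S1| ->
      #|[set K in minor_hypergraph A k a | K \subset S]| = 0%N.
    move=> cS; apply: eq_card0 => K; rewrite !inE; apply/negbTE/negP.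
    case/andP => /andP[/eqP cK _] /subset_leq_card.
    by rewrite cK cS leqNgt ltSk.
  by rewrite !none.
have -> : v%:Z - k%:Z - i%:Z = Posz (#|S1| - k).
  by rewrite -{1}eS1 -subzn // PoszD addrAC addrK.
rewrite /coefz !(@coef_char_poly_principal_submx _ _ k) ?eS ?subnK //.
move/(mulrI (unitrX k (unitrN1 C))).
rewrite !(sum_two_valued_minors _ Aab) eS => /addrI eN.
apply/eqP; rewrite -(eqr_nat C); apply/eqP.
apply: (@mulfI _ (a - b)); first by rewrite subr_eq0; apply/eqP.
by rewrite !mulr_natr.
Qed.

Theorem theorem1p1 (R : realType) (t v k : nat)
    (ht : (0 < t)%N) (hv : (0 < v)%N) (hk : (0 < k)%N)
    (A : 'M[R[i]]_v) (a b : R[i]) (hab : a <> b)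
    (hminors : forall z : R[i],
       (exists2 K : {set 'I_v}, #|K| = k & principal_minor A K = z)
       <-> (z = a \/ z = b))
    (hcoef : forall i : nat, (i <= t)%N ->
       forall S1 S2 : {set 'I_v}, (#|S1| + i = v)%N -> (#|S2| + i = v)%N ->
       coefz (char_poly (principal_submx A S1)) (v%:Z - k%:Z - i%:Z)
       = coefz (char_poly (principal_submx A S2)) (v%:Z - k%:Z - i%:Z)) :
  exists lambda : nat, is_design t v k lambda (minor_hypergraph A k a).
Proof.
have Aab (K : {set 'I_v}) : #|K| = k ->
    principal_minor A K = a \/ principal_minor A K = b.
  by move=> cK; apply/hminors; exists K.
have [Ka cKa mKa] : exists2 K : {set 'I_v}, #|K| = k & principal_minor A K = a.
  by apply/hminors; left.
have [Kb cKb mKb] : exists2 K : {set 'I_v}, #|K| = k & principal_minor A K = b.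
  by apply/hminors; right.
set H := minor_hypergraph A k a.
have KaH : Ka \in H by rewrite inE cKa mKa !eqxx.
have contain (X X' : {set 'I_v}) : #|X| = #|X'| -> (#|X| <= t)%N ->
    #|[set K in H | X \subset K]| = #|[set K in H | X' \subset K]|.
  move=> eX leX.
  have avoid0 (Z : {set 'I_v}) : [set K in H | Z \subset K]
      = [set K in H | (Z \subset K) && (K \subset ~: set0)].
    by apply/setP => K; rewrite !inE setC0 subsetT andbT.
  (* Start from an empty avoided set; the counts avoiding [Y] are then handled by the coefficient
     hypothesis at [i = #|Y|], applied to [~: Y]. *)
  rewrite !avoid0; apply: (@card_containing_avoiding _ H t);
    rewrite ?cards0 ?addn0 // 1?disjoint_sym ?disjoints_subset ?sub0set //.
  move=> Y Y' eY leY.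
  have cC (Z : {set 'I_v}) : #|Z| = #|Y| -> (#|~: Z| + #|Y| = v)%N.
    by move=> <-; rewrite addnC cardsC card_ord.
  apply: (minor_hypergraph_card_subset hab Aab (cC _ _) (cC _ _)) => //.
  by apply: hcoef => //; exact: cC.
have ltk : (t < k)%N.
  (* If [k <= t], then [Kb], like [Ka], lies in a hyperedge; having the same size it equals that
     hyperedge, whose minor is [a]. *)
  rewrite ltnNge; apply/negP => lekt.
  have : (0 < #|[set K in H | Kb \subset K]|)%N.
    rewrite -(contain Ka) ?cKa ?cKb //.
    by apply/card_gt0P; exists Ka; rewrite inE KaH subxx.
  case/card_gt0P => K; rewrite !inE -andbA => /and3P[/eqP cK /eqP mK sK].
  have eK : Kb = K by apply/eqP; rewrite eqEcard sK cK cKb leqnn.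
  by apply: hab; rewrite -mK -mKb eK.
have [X0 [sX0 cX0]] : exists X0 : {set 'I_v}, X0 \subset Ka /\ #|X0| = t.
  have : (0 < #|[set B : {set 'I_v} | B \subset Ka & #|B| == t]|)%N.
    by rewrite cards_draws cKa bin_gt0 ltnW.
  by case/card_gt0P => B; rewrite inE => /andP[sB /eqP cB]; exists B.
exists #|[set K in H | X0 \subset K]|; split.
- by split=> //; apply/card_gt0P; exists Ka; rewrite inE KaH sX0.
- exact: card_ord.
- by move=> K; rewrite inE => /andP[/eqP].
- by move=> X cX; apply: contain; rewrite ?cX ?cX0.
Qed.
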